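(* Let $R$ be a commutative ring with identity, let $\iota: \operatorname{Spec}(R)\rightarrow QPrim(R)$ be the inclusion map, and let $\mathcal{O}$ be the structure sheaf on $\operatorname{Spec}(R)$. Then the sheaf of rings $\mathcal{F}$ on $QPrim(R)$ (defined in the context) is equal to the direct image sheaf $\iota_*\mathcal{O}$ of $\mathcal{O}$ under $\iota$.
   Context: All rings are commutative with identity. An ideal $I$ of $R$ is quasi-primary if its radical $\sqrt{I}$ is a prime ideal; $QPrim(R)$ denotes the set of all quasi-primary ideals of $R$. It carries the Zariski topology, whose closed sets are the sets $V_q(I)=\{Q\in QPrim(R): I\subseteq \sqrt{Q}\}$ for ideals $I$ of $R$. For $a\in R$ write $V_q(a)=\{Q\in QPrim(R): a\in\sqrt{Q}\}$ and $U_a=QPrim(R)\setminus V_q(a)$; the sets $U_a$ form a base of the topology. Every prime ideal is quasi-primary, so $\operatorname{Spec}(R)\subseteq QPrim(R)$, and $\iota$ is this inclusion ($\operatorname{Spec}(R)$ has its usual Zariski topology). The sheaf $\mathcal{F}$ on $QPrim(R)$: for $a\in R$ put $\mathcal{F}(U_a):=R_a$, the ring of quotients of $R$ with respect to $\{1,a,a^2,\dots\}$. One has $U_a\subseteq U_b$ if and only if $a^n=tb$ for some positive integer $n$ and some $t\in R$, and in that case the restriction map is $res_{U_b,U_a}:R_b\to R_a$, $r/b^m\mapsto t^m r/a^{nm}$. For an arbitrary open set $U$ of $QPrim(R)$, $\mathcal{F}(U)=\varprojlim \mathcal{F}(U_a)$, the projective limit taken over all $U_a\subseteq U$ relative to the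 maps $res_{U_b,U_a}$ for $U_a\subseteq U_b$. For open sets $U\subseteq V$, the restriction map $res_{V,U}:\mathcal{F}(V)\to\mathcal{F}(U)$ sends a compatible family indexed by the $U_{a_i}\subseteq V$ to its subfamily indexed by those $U_{a_j}\subseteq U$. The direct image sheaf is given by $(\iota_*\mathcal{O})(U)=\mathcal{O}(\iota^{-1}(U))$ for open $U\subseteq QPrim(R)$. As usual, the sections of $\mathcal{O}$ over the principal open set $X_a=\{P\in \operatorname{Spec}(R): a\notin P\}$ are identified with $R_a$. *)

(* Defs.v *)
From HB Require Import structures.
From mathcomp Require Import all_boot all_algebra all_classical.
From mathcomp Require Import generic_quotient topology_structure ring.

Set Implicit Arguments.
Unset Strict Implicit.
Unset Printing Implicit Defensive.

Import GRing.Theory.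
Local Open Scope classical_set_scope.
Local Open Scope quotient_scope.
Local Open Scope ring_scope.

(* Rings are [comPzRingType]s, so the zero ring is allowed; this matters since
   R_a is the zero ring when a is nilpotent, and Spec(0) is empty. *)

(* The ideals of mathcomp's [ring_quotient] are proper by definition, and live
   in a nonzero ring; the closed sets V(I) below range over all ideals. *)
Definition is_ideal (R : comPzRingType) (I : set R) : Prop :=
  [/\ I 0, forall x y, I x -> I y -> I (x + y) & forall r x, I x -> I (r * x)].

Definition prime_ideal (R : comPzRingType) (P : set R) : Prop :=
  [/\ is_ideal P, ~ P 1 & forall x y, P (x * y) -> P x \/ P y].

Definition radical (R : comPzRingType) (I : set R) : set R :=
  [set x | exists n, I (x ^+ n)].

Definition quasi_primary (R : comPzRingType) (Q : set R) : Prop :=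
  is_ideal Q /\ prime_ideal (radical Q).

Section IdealTheory.
Variable R : comPzRingType.
Implicit Types (I J P : set R) (a b x y : R).

Lemma ideal0 I : is_ideal I -> I 0. Proof. by case. Qed.

Lemma idealD I x y : is_ideal I -> I x -> I y -> I (x + y).
Proof. by case=> _ + _; exact. Qed.

Lemma idealMl I r x : is_ideal I -> I x -> I (r * x).
Proof. by case=> _ _; exact. Qed.

Lemma prime_is_ideal P : prime_ideal P -> is_ideal P. Proof. by case. Qed.

Lemma prime_idealX P x n : prime_ideal P -> P (x ^+ n) -> P x.
Proof.
move=> [_ P1 PM]; elim: n => [|n IHn]; first by rewrite expr0 => /P1.
by rewrite exprS => /PM[].
Qed.

Lemma subset_radical I : I `<=` radical I.
Proof. by move=> x Ix; exists 1%N; rewrite expr1. Qed.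

Lemma radical_prime P : prime_ideal P -> radical P = P.
Proof.
move=> Pp; apply/seteqP; split=> [x [n]|]; first exact: prime_idealX.
exact: subset_radical.
Qed.

Lemma prime_quasi_primary P : prime_ideal P -> quasi_primary P.
Proof. by move=> Pp; split; [case: Pp | rewrite radical_prime]. Qed.

Definition principal_ideal b : set R := [set x | exists t, x = t * b].

Lemma principal_is_ideal b : is_ideal (principal_ideal b).
Proof.
split=> [|_ _ [s ->] [t ->]|r _ [t ->]].
- by exists 0; rewrite mul0r.
- by exists (s + t); rewrite mulrDl.
- by exists (r * t); rewrite mulrA.
Qed.

Lemma prime_avoid I a : is_ideal I -> (forall n, ~ I (a ^+ n)) ->
  exists P, [/\ prime_ideal P, I `<=` P & ~ P a].
Proof.
move=> II Ia.
pose ok A := is_ideal (A `|` I) /\ forall n, ~ (A `|` I) (a ^+ n).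
have [F okF totF|A [[iA aA] maxA]] := @Zorn_bigcup R ok.
  have [F0|/eqP/set0P[A0 FA0]] := pselect (F = set0).
    by rewrite F0 bigcup_set0 /ok set0U.
  split; last first.
    move=> n [[A FA An]|]; last exact: Ia.
    by have [_ /(_ n)] := okF _ FA; apply; left.
  split.
  - by right; exact: ideal0.
  - move=> x y [[A FA Ax]|Ix] [[B FB By]|Iy].
    + have [AB|BA] := totF _ _ FA FB.
      * have [[_ D _] _] := okF _ FB.
        have [|] := D x y (or_introl (AB _ Ax)) (or_introl By); last by right.
        by left; exists B.
      * have [[_ D _] _] := okF _ FA.
        have [|] := D x y (or_introl Ax) (or_introl (BA _ By)); last by right.
        by left; exists A.
    + have [[_ D _] _] := okF _ FA.
      have [|] := D x y (or_introl Ax) (or_intror Iy); last by right.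
      by left; exists A.
    + have [[_ D _] _] := okF _ FB.
      have [|] := D x y (or_intror Ix) (or_introl By); last by right.
      by left; exists B.
    + by right; exact: idealD.
  - move=> r x [[A FA Ax]|Ix]; last by right; exact: idealMl.
    have [[_ _ M] _] := okF _ FA.
    have [|] := M r x (or_introl Ax); last by right.
    by left; exists A.
pose B := A `|` I.
have enlarge x : ~ B x -> exists n r t, B t /\ a ^+ n = t + r * x.
  move=> Bx; pose C := [set z | exists t r, B t /\ z = t + r * x].
  have BC : B `<=` C by move=> z Bz; exists z, 0; rewrite mul0r addr0.
  have IC : is_ideal C.
    split; first by apply: BC; exact: ideal0.
    - move=> _ _ [t [r [Bt ->]]] [t' [r' [Bt' ->]]]; exists (t + t'), (r + r').
      by split; [exact: idealD | rewrite mulrDl addrACA].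
    - move=> s _ [t [r [Bt ->]]]; exists (s * t), (s * r).
      by split; [exact: idealMl | rewrite mulrDr mulrA].
  have CI : C `|` I = C.
    by apply/seteqP; split=> z; [case=> // Iz; apply: BC; right | left].
  have Cx : C x by exists 0, 1; rewrite mul1r add0r; split; first exact: ideal0.
  have AC : A `<` C.
    split; first by move=> z Az; apply: BC; left.
    by move=> CA; apply: Bx; left; exact: CA.
  have := maxA _ AC; rewrite /ok CI => /not_andP[//|/existsNP[n /contrapT]].
  by move=> [t [r [Bt E]]]; exists n, r, t.
exists B; split; last 2 first.
- by move=> x; right.
- by rewrite -[a]expr1; exact: aA.
split=> //; first by rewrite -(expr0 a); exact: aA.
move=> x y Bxy; have [|Bx] := pselect (B x); first by left.
have [|By] := pselect (B y); [by right | exfalso].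
have [n [r [t [Bt En]]]] := enlarge _ Bx.
have [m [s [u [Bu Em]]]] := enlarge _ By.
apply: (aA (n + m)%N); rewrite exprD En Em.
have -> : (t + r * x) * (u + s * y)
   = (u + s * y) * t + (r * x * u + r * s * (x * y)) by ring.
apply: idealD => //; first exact: idealMl.
by apply: idealD => //; exact: idealMl.
Qed.

End IdealTheory.

Record mulset (R : comPzRingType) := MulSet {
  mset : set R;
  mset1 : mset 1;
  msetM : forall x y, mset x -> mset y -> mset (x * y) }.

Record den (R : comPzRingType) (S : mulset R) := Den {
  dval : R;
  denP : mset S dval }.

HB.instance Definition _ R S := gen_eqMixin (@den R S).
HB.instance Definition _ R S := gen_choiceMixin (@den R S).

Section Localization.
Variables (R : comPzRingType) (S : mulset R).

Definition fraceq (x y : R * den S) : bool :=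
  `[< exists2 u, mset S u & u * (x.1 * dval y.2) = u * (y.1 * dval x.2) >].

Lemma fraceq_refl : reflexive fraceq.
Proof. by move=> x; apply/asboolP; exists 1 => //; exact: mset1. Qed.

Lemma fraceq_sym : symmetric fraceq.
Proof. by move=> x y; apply/asboolP/asboolP => -[u Su E]; exists u. Qed.

Lemma fraceq_trans : transitive fraceq.
Proof.
move=> [y v] [x s] [z t] /asboolP[/= u Su Exy] /asboolP[/= w Sw Eyz].
apply/asboolP; exists (u * w * dval v) => /=.
  by apply: msetM; [exact: msetM | exact: denP].
transitivity (w * dval t * (u * (x * dval v))); first by ring.
rewrite Exy; transitivity (u * dval s * (w * (y * dval t))); first by ring.
by rewrite Eyz; ring.
Qed.

Canonical fraceq_equiv := EquivRel fraceq fraceq_refl fraceq_sym fraceq_trans.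

Definition loc := {eq_quot fraceq_equiv}.

HB.instance Definition _ := EqQuotient.on loc.
HB.instance Definition _ := Choice.on loc.

Definition frac (r : R) (s : den S) : loc := \pi_loc (r, s).

Lemma fracP (x : loc) : exists r s, x = frac r s.
Proof.
by elim/quotW: x => -[r s]; exists r, s.
Qed.

Lemma eq_frac r s r' s' : frac r s = frac r' s' <->
  exists2 u, mset S u & u * (r * dval s') = u * (r' * dval s).
Proof.
rewrite /frac; split=> [/eqP|h]; first by rewrite eqmodE => /asboolP.
by apply/eqP; rewrite eqmodE; apply/asboolP.
Qed.

Lemma repr_frac r s :
  exists2 u, mset S u & u * ((repr (frac r s)).1 * dval s)
                   = u * (r * dval (repr (frac r s)).2).
Proof.
apply/eq_frac; rewrite /frac -[RHS]reprK.
by case: (repr (\pi_loc (r, s))).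
Qed.

Definition one_den : den S := Den (mset1 S).

Definition mul_den (s t : den S) : den S :=
  Den (msetM (denP s) (denP t)).

Definition loc_add (x y : loc) : loc :=
  let: (r, s) := repr x in let: (r', s') := repr y in
  frac (r * dval s' + r' * dval s) (mul_den s s').

Definition loc_opp (x : loc) : loc := let: (r, s) := repr x in frac (- r) s.

Definition loc_mul (x y : loc) : loc :=
  let: (r, s) := repr x in let: (r', s') := repr y in
  frac (r * r') (mul_den s s').

Lemma loc_addE r s r' s' : loc_add (frac r s) (frac r' s')
  = frac (r * dval s' + r' * dval s) (mul_den s s').
Proof.
rewrite /loc_add; have := repr_frac r s; have := repr_frac r' s'.
case: (repr (frac r s)) => [p t]; case: (repr (frac r' s')) => [p' t'] /=.
move=> [u' Su' E'] [u Su E]; apply/eq_frac; exists (u * u'); first exact: msetM.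
rewrite /=; transitivity (u * (p * dval s) * (u' * dval t' * dval s')
  + u' * (p' * dval s') * (u * dval t * dval s)); first by ring.
by rewrite E E'; ring.
Qed.

Lemma loc_oppE r s : loc_opp (frac r s) = frac (- r) s.
Proof.
rewrite /loc_opp; have := repr_frac r s; case: (repr (frac r s)) => [p t] /=.
by move=> [u Su E]; apply/eq_frac; exists u => //; rewrite !mulNr !mulrN E.
Qed.

Lemma loc_mulE r s r' s' : loc_mul (frac r s) (frac r' s')
  = frac (r * r') (mul_den s s').
Proof.
rewrite /loc_mul; have := repr_frac r s; have := repr_frac r' s'.
case: (repr (frac r s)) => [p t]; case: (repr (frac r' s')) => [p' t'] /=.
move=> [u' Su' E'] [u Su E]; apply/eq_frac; exists (u * u'); first exact: msetM.
rewrite /=; transitivity (u * (p * dval s) * (u' * (p' * dval s'))).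
  by ring.
by rewrite E E'; ring.
Qed.

Lemma eq_frac1 r s r' s' : r * dval s' = r' * dval s -> frac r s = frac r' s'.
Proof. by move=> E; apply/eq_frac; exists 1; [exact: mset1 | rewrite E]. Qed.

Lemma loc_addA : associative loc_add.
Proof.
move=> x y z; have [r [s ->]] := fracP x; have [r' [s' ->]] := fracP y.
have [r2 [s2 ->]] := fracP z.
by rewrite !loc_addE; apply: eq_frac1 => /=; ring.
Qed.

Lemma loc_addC : commutative loc_add.
Proof.
move=> x y; have [r [s ->]] := fracP x; have [r' [s' ->]] := fracP y.
by rewrite !loc_addE; apply: eq_frac1 => /=; ring.
Qed.

Lemma loc_add0 : left_id (frac 0 one_den) loc_add.
Proof.
move=> x; have [r [s ->]] := fracP x.
by rewrite !loc_addE; apply: eq_frac1 => /=; ring.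
Qed.

Lemma loc_addN : left_inverse (frac 0 one_den) loc_opp loc_add.
Proof.
move=> x; have [r [s ->]] := fracP x.
by rewrite loc_oppE loc_addE; apply: eq_frac1 => /=; ring.
Qed.

HB.instance Definition _ :=
  GRing.isZmodule.Build loc loc_addA loc_addC loc_add0 loc_addN.

Lemma loc_mulA : associative loc_mul.
Proof.
move=> x y z; have [r [s ->]] := fracP x; have [r' [s' ->]] := fracP y.
have [r2 [s2 ->]] := fracP z.
by rewrite !loc_mulE; apply: eq_frac1 => /=; ring.
Qed.

Lemma loc_mulC : commutative loc_mul.
Proof.
move=> x y; have [r [s ->]] := fracP x; have [r' [s' ->]] := fracP y.
by rewrite !loc_mulE; apply: eq_frac1 => /=; ring.
Qed.

Lemma loc_mul1 : left_id (frac 1 one_den) loc_mul.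
Proof.
move=> x; have [r [s ->]] := fracP x.
by rewrite !loc_mulE; apply: eq_frac1 => /=; ring.
Qed.

Lemma loc_mulDl : left_distributive loc_mul loc_add.
Proof.
move=> x y z; have [r [s ->]] := fracP x; have [r' [s' ->]] := fracP y.
have [r2 [s2 ->]] := fracP z.
by rewrite loc_addE !loc_mulE loc_addE; apply: eq_frac1 => /=; ring.
Qed.

HB.instance Definition _ := GRing.Zmodule_isComPzRing.Build loc
  loc_mulA loc_mulC loc_mul1 loc_mulDl.

Lemma fracD r s r' s' : frac r s + frac r' s'
  = frac (r * dval s' + r' * dval s) (mul_den s s').
Proof. exact: loc_addE. Qed.

Lemma fracN r s : - frac r s = frac (- r) s.
Proof. exact: loc_oppE. Qed.

Lemma fracM r s r' s' : frac r s * frac r' s' = frac (r * r') (mul_den s s').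
Proof. exact: loc_mulE. Qed.

Lemma frac0 : 0 = frac 0 one_den. Proof. by []. Qed.

Lemma frac1 : 1 = frac 1 one_den. Proof. by []. Qed.

End Localization.

Section LocMap.
Variables (R : comPzRingType) (S T : mulset R)
  (ST : forall s, mset S s -> exists u, mset T (u * s)).

Definition loc_mult (s : den S) : R := xget 0 [set u | mset T (u * dval s)].

Lemma loc_multP (s : den S) : mset T (loc_mult s * dval s).
Proof.
rewrite /loc_mult; case: xgetP => [u -> //|noU].
by have [u /(noU u)] := ST (denP s).
Qed.

(* The canonical map S^-1 R -> T^-1 R, which exists as soon as every s in S
   becomes invertible in T^-1 R: r/s is sent to (u r)/(u s) for any u such that
   u s lies in T, see [loc_mapE]. *)
Definition loc_map (x : loc S) : loc T :=
  let: (r, s) := repr x in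
  frac (loc_mult s * r) (Den (loc_multP s)).

Lemma loc_mapE r (s : den S) u (us : den T) :
  dval us = u * dval s -> loc_map (frac r s) = frac (u * r) us.
Proof.
rewrite /loc_map; have := repr_frac r s; case: (repr (frac r s)) => [p t] /=.
move=> [w Sw E] Eus; apply/eq_frac; rewrite /= Eus.
have [w' Tw'] := ST Sw; exists (w' * w) => //.
transitivity (loc_mult t * w' * u * (w * (p * dval s))); first by ring.
by rewrite E; ring.
Qed.

Lemma loc_mapP r s : exists u (us : den T),
  dval us = u * dval s /\ loc_map (frac r s) = frac (u * r) us.
Proof.
exists (loc_mult s), (Den (loc_multP s)).
by split; last exact: loc_mapE.
Qed.

Lemma loc_map_zmod_morphism : zmod_morphism loc_map.
Proof.
move=> x y; have [r [s ->]] := fracP x; have [r' [s' ->]] := fracP y.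
have [u [us [Es ->]]] := loc_mapP r s.
have [u' [us' [Es' ->]]] := loc_mapP r' s'.
rewrite !fracN !fracD (@loc_mapE _ _ (u * u') (mul_den us us')) /= ?Es ?Es'.
  by apply: eq_frac1 => /=; rewrite Es Es'; ring.
by ring.
Qed.

Lemma loc_map_monoid_morphism : monoid_morphism loc_map.
Proof.
split=> [|x y].
  rewrite !frac1 (@loc_mapE _ _ 1 (one_den T)) /= ?mulr1 //.
have [r [s ->]] := fracP x; have [r' [s' ->]] := fracP y.
have [u [us [Es ->]]] := loc_mapP r s.
have [u' [us' [Es' ->]]] := loc_mapP r' s'.
rewrite !fracM (@loc_mapE _ _ (u * u') (mul_den us us')) /= ?Es ?Es'.
  by apply: eq_frac1 => /=; ring.
by ring.
Qed.

HB.instance Definition _ :=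
  GRing.isZmodMorphism.Build (loc S) (loc T) loc_map loc_map_zmod_morphism.
HB.instance Definition _ :=
  GRing.isMonoidMorphism.Build (loc S) (loc T) loc_map loc_map_monoid_morphism.

End LocMap.

Section LocMapComp.
Variables (R : comPzRingType) (S T U : mulset R).

Lemma loc_map_id (H : forall s, mset S s -> exists u, mset S (u * s)) x :
  loc_map H x = x.
Proof.
have [r [s ->]] := fracP x; rewrite (@loc_mapE _ _ _ H _ _ 1 s) ?mul1r //.
Qed.

Lemma loc_map_comp (ST : forall s, mset S s -> exists u, mset T (u * s))
    (TU : forall s, mset T s -> exists u, mset U (u * s))
    (SU : forall s, mset S s -> exists u, mset U (u * s)) x :
  loc_map TU (loc_map ST x) = loc_map SU x.
Proof.
have [r [s ->]] := fracP x; have [u [us [E ->]]] := loc_mapP ST r s.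
have [v [vus [E' ->]]] := loc_mapP TU (u * r) us.
by rewrite mulrA -(@loc_mapE _ _ _ SU r s (v * u) vus) // E' E mulrA.
Qed.

End LocMapComp.

Section Multiplicative.
Variable R : comPzRingType.
Implicit Types a b t : R.

Lemma powers1 a : [set x | exists n, x = a ^+ n] 1.
Proof. by exists 0%N; rewrite expr0. Qed.

Lemma powersM a x y : [set z | exists n, z = a ^+ n] x ->
  [set z | exists n, z = a ^+ n] y -> [set z | exists n, z = a ^+ n] (x * y).
Proof. by move=> [n ->] [m ->]; exists (n + m)%N; rewrite exprD. Qed.

Definition powers a : mulset R := MulSet (powers1 a) (@powersM a).

Definition pow_den a n : den (powers a) :=
  @Den _ (powers a) (a ^+ n) (ex_intro (fun m => a ^+ n = a ^+ m) n erefl).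

Definition loc_at a : comPzRingType := loc (powers a).

Definition frac_at a (r : R) (m : nat) : loc_at a := frac r (pow_den a m).

End Multiplicative.

Record opens (T : topologicalType) := Opens {
  oset :> set T;
  oset_open : open oset }.

Section Opens.
Variable T : topologicalType.

Definition opens_setI (U V : opens T) : opens T :=
  Opens (openI (oset_open U) (oset_open V)).

End Opens.

Record presheaf (T : topologicalType) := Presheaf {
  sect :> opens T -> comPzRingType;
  res : forall U V : opens T, U `<=` V -> {rmorphism sect V -> sect U};
  res_id : forall (U : opens T) (UU : U `<=` U) s, res UU s = s;
  res_comp : forall (U V W : opens T) (UV : U `<=` V) (VW : V `<=` W)
    (UW : U `<=` W) s, res UV (res VW s) = res UW s }.

Arguments res {T} p {U V}.

Definition separated (T : topologicalType) (F : presheaf T) : Prop :=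
  forall (I : Type) (V : I -> opens T) (U : opens T)
    (VU : forall i, V i `<=` U), U `<=` \bigcup_i V i ->
  forall s t : F U, (forall i, res F (VU i) s = res F (VU i) t) -> s = t.

Definition gluing (T : topologicalType) (F : presheaf T) : Prop :=
  forall (I : Type) (V : I -> opens T) (U : opens T)
    (VU : forall i, V i `<=` U), U `<=` \bigcup_i V i ->
  forall s : (forall i, F (V i)),
    (forall i j, res F (@subIsetl _ (V i) (V j)
                          : opens_setI (V i) (V j) `<=` V i) (s i)
               = res F (@subIsetr _ (V i) (V j)
                          : opens_setI (V i) (V j) `<=` V j) (s j)) ->
  exists t : F U, forall i, res F (VU i) t = s i.

Definition is_sheaf (T : topologicalType) (F : presheaf T) : Prop :=
  separated F /\ gluing F.

(* Isomorphisms of sheaves are isomorphisms of the underlying presheaves. *)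
Record presheaf_iso (T : topologicalType) (F G : presheaf T) := PresheafIso {
  iso_map :> forall U : opens T, {rmorphism F U -> G U};
  iso_bij : forall U, bijective (iso_map U);
  iso_nat : forall (U V : opens T) (UV : U `<=` V) s,
    iso_map U (res F UV s) = res G UV (iso_map V s) }.

Section DirectImage.
Variables (X Y : topologicalType) (f : X -> Y).
Hypothesis fcont : continuous f.

Definition opens_preim (U : opens Y) : opens X :=
  Opens ((continuousP f).1 fcont _ (oset_open U)).

Variable O : presheaf X.

Definition direct_image : presheaf Y := @Presheaf Y
  (fun U => O (opens_preim U))
  (fun U V UV => res O (preimage_subset UV : opens_preim U `<=` opens_preim V))
  (fun U _ => res_id _)
  (fun U V W _ _ _ => res_comp _ _ _).

End DirectImage.

Lemma direct_image_is_sheaf (X Y : topologicalType) (f : X -> Y)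
    (fcont : continuous f) (O : presheaf X) :
  is_sheaf O -> is_sheaf (direct_image fcont O).
Proof.
move=> [sepO gluO]; split=> [I V U VU cov s t E|I V U VU cov s E].
  apply: (sepO _ (fun i => opens_preim fcont (V i))) E.
  by move=> x /cov[i _ Vx]; exists i.
have [||t Et] := gluO _ (fun i => opens_preim fcont (V i))
  (opens_preim fcont U) (fun i => preimage_subset (VU i)) _ s.
- by move=> x /cov[i _ Vx]; exists i.
- move=> i j; set W := opens_setI _ _ => /=.
  have WE : W `<=` opens_preim fcont (opens_setI (V i) (V j)) by [].
  pose Wl : opens_preim fcont (opens_setI (V i) (V j))
    `<=` opens_preim fcont (V i) := preimage_subset (@subIsetl _ (V i) (V j)).
  pose Wr : opens_preim fcont (opens_setI (V i) (V j))
    `<=` opens_preim fcont (V j) := preimage_subset (@subIsetr _ (V i) (V j)).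
  rewrite -(res_comp WE Wl) -(res_comp WE Wr).
  by have H := congr1 (res O WE) (E i j); exact: H.
- by exists t.
Qed.

Definition dprod (I : Type) (A : I -> comPzRingType) : Type := forall i, A i.

Section Product.
Variables (I : Type) (A : I -> comPzRingType).
Local Notation T := (dprod A).

HB.instance Definition _ := gen_eqMixin T.
HB.instance Definition _ := gen_choiceMixin T.

Definition dprod_zero : T := fun i => 0.
Definition dprod_one : T := fun i => 1.
Definition dprod_opp (f : T) : T := fun i => - f i.
Definition dprod_add (f g : T) : T := fun i => f i + g i.
Definition dprod_mul (f g : T) : T := fun i => f i * g i.

Lemma dprodP (f g : T) : (forall i, f i = g i) -> f = g.
Proof. exact: functional_extensionality_dep. Qed.

Lemma dprod_addA : associative dprod_add.
Proof. by move=> f g h; apply: dprodP => i; exact: addrA. Qed.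
Lemma dprod_addC : commutative dprod_add.
Proof. by move=> f g; apply: dprodP => i; exact: addrC. Qed.
Lemma dprod_add0 : left_id dprod_zero dprod_add.
Proof. by move=> f; apply: dprodP => i; exact: add0r. Qed.
Lemma dprod_addN : left_inverse dprod_zero dprod_opp dprod_add.
Proof. by move=> f; apply: dprodP => i; exact: addNr. Qed.

HB.instance Definition _ :=
  GRing.isZmodule.Build T dprod_addA dprod_addC dprod_add0 dprod_addN.

Lemma dprod_mulA : associative dprod_mul.
Proof. by move=> f g h; apply: dprodP => i; exact: mulrA. Qed.
Lemma dprod_mulC : commutative dprod_mul.
Proof. by move=> f g; apply: dprodP => i; exact: mulrC. Qed.
Lemma dprod_mul1 : left_id dprod_one dprod_mul.
Proof. by move=> f; apply: dprodP => i; exact: mul1r. Qed.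
Lemma dprod_mulDl : left_distributive dprod_mul dprod_add.
Proof. by move=> f g h; apply: dprodP => i; exact: mulrDl. Qed.

HB.instance Definition _ := GRing.Zmodule_isComPzRing.Build T
  dprod_mulA dprod_mulC dprod_mul1 dprod_mulDl.

End Product.

(* The topology whose closed sets are the {x | I `<=` g x}, for a family g of
   prime ideals: g P = P gives Spec R, and g Q = radical Q gives QPrim R. *)
Section Zariski.
Variables (R : comPzRingType) (T : Type) (g : T -> set R).
Hypothesis gP : forall x, prime_ideal (g x).

Definition zariski_open : set (set T) :=
  [set U | exists2 I, is_ideal I & U = ~` [set x | I `<=` g x]].

Lemma zariski_openT : zariski_open setT.
Proof.
exists setT; first by split.
apply/seteqP; split=> // x _ /= gT.
by have [_ + _] := gP x; apply; exact: gT.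
Qed.

Lemma zariski_openI : setI_closed zariski_open.
Proof.
move=> _ _ [I II ->] [J IJ ->]; exists (I `&` J).
  split=> [|x y [Ix Jx] [Iy Jy]|r x [Ix Jx]].
  - by split; exact: ideal0.
  - by split; exact: idealD.
  - by split; exact: idealMl.
apply/seteqP; split=> x /=; last first.
  by move=> IJx; split=> Kx; apply: IJx => z [Iz Jz]; exact: Kx.
move=> [Ix Jx] IJx; apply: Ix => y Iy; apply: contrapT => gy.
apply: Jx => z Jz; have [_ _ /(_ y z)] := gP x.
have gyz : g x (y * z).
  by apply: IJx; split; [rewrite mulrC|]; exact: idealMl.
by move=> /(_ gyz)[].
Qed.

Lemma zariski_open_bigU (K : Type) (f : K -> set T) :
  (forall k, zariski_open (f k)) -> zariski_open (\bigcup_k f k).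
Proof.
move=> fo; pose I k := sval (cid2 (fo k)).
have II k : is_ideal (I k) by rewrite /I; case: cid2.
have fE k : f k = ~` [set x | I k `<=` g x] by rewrite /I; case: cid2.
exists [set z | forall J : set R, is_ideal J -> (forall k, I k `<=` J) -> J z].
  split=> [J IJ _|x y Hx Hy J IJ kJ|r x Hx J IJ kJ].
  - exact: ideal0.
  - by apply: idealD => //; [exact: Hx | exact: Hy].
  - by apply: idealMl => //; exact: Hx.
apply/seteqP; split=> x /=.
  move=> [k _]; rewrite fE /= => Ikx Ix; apply: Ikx => z Iz; apply: Ix => J _ IJ.
  exact: IJ Iz.
move=> Ix; apply: contrapT => fx; apply: Ix => z; apply.
  by have [] := gP x.
move=> k; apply: contrapT => Ikx; apply: fx; exists k => //.
by rewrite fE.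
Qed.

Lemma zariski_open_basic (a : R) : zariski_open [set x | ~ g x a].
Proof.
exists (principal_ideal a); first exact: principal_is_ideal.
apply/seteqP; split=> x /= gxa; last first.
  by move=> gx; apply: gxa => _ [t ->]; exact: idealMl (prime_is_ideal (gP x)) gx.
by move=> ax; apply: gxa; apply: ax; exists 1; rewrite mul1r.
Qed.

End Zariski.

Record spec (R : comPzRingType) := SpecPoint {
  spec_ideal : set R;
  spec_prime : prime_ideal spec_ideal }.

Section SpecTopology.
Variable R : comPzRingType.

HB.instance Definition _ := gen_eqMixin (spec R).
HB.instance Definition _ := gen_choiceMixin (spec R).

Definition spec_closed (I : set R) : set (spec R) :=
  [set P | I `<=` spec_ideal P].

Definition spec_open : set (set (spec R)) :=
  [set U | exists2 I, is_ideal I & U = ~` spec_closed I].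

HB.instance Definition _ := isOpenTopological.Build (spec R)
  (zariski_openT (@spec_prime R) : spec_open setT)
  (zariski_openI (@spec_prime R) : setI_closed spec_open)
  (zariski_open_bigU (@spec_prime R)).

Definition basic_open (a : R) : opens (spec R) :=
  Opens (zariski_open_basic (@spec_prime R) a
    : open [set P : spec R | ~ spec_ideal P a]).

Lemma prime_compl1 (P : spec R) : ~ spec_ideal P 1.
Proof. by have [] := spec_prime P. Qed.

Lemma prime_complM (P : spec R) x y :
  ~ spec_ideal P x -> ~ spec_ideal P y -> ~ spec_ideal P (x * y).
Proof. by have [_ _ PM] := spec_prime P => Px Py /PM[]. Qed.

Definition prime_compl (P : spec R) : mulset R :=
  @MulSet R (~` spec_ideal P) (@prime_compl1 P) (@prime_complM P).

Definition loc_prime (P : spec R) : comPzRingType := loc (prime_compl P).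

Definition frac_prime (P : spec R) (r f : R) (Pf : ~ spec_ideal P f) :
    loc_prime P :=
  frac r (@Den R (prime_compl P) f Pf).

End SpecTopology.

Section StructureSheaf.
Variable R : comPzRingType.
Implicit Types U V W : opens (spec R).

Definition in_open U := {P : spec R | oset U P}.

(* Sections over U are the families s(P) in R_P, P in U, such that every P in U
   has an open neighbourhood on which s is a single fraction r / f. *)
Definition locally_frac U (s : dprod (fun P : in_open U => loc_prime (sval P)))
    : Prop :=
  forall P : in_open U, exists V, [/\ oset V (sval P), V `<=` U &
    exists r f : R, forall Q : in_open U, oset V (sval Q) ->
      exists Qf : ~ spec_ideal (sval Q) f, s Q = frac_prime r Qf].

Definition locally_fracb U : {pred dprod (fun P : in_open U => loc_prime (sval P))} :=
  fun s => `[< locally_frac s >].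

Lemma locally_frac_subring_closed U : subring_closed (@locally_fracb U).
Proof.
split=> [|s t /asboolP sf /asboolP tf|s t /asboolP sf /asboolP tf].
- apply/asboolP => P; exists U; split=> //; first exact: (svalP P).
  exists 1, 1 => Q _; exists (@prime_compl1 R (sval Q)).
  by apply: eq_frac1.
- apply/asboolP => P; have [V [VP VU [r [f sE]]]] := sf P.
  have [W [WP WU [r' [f' tE]]]] := tf P.
  exists (opens_setI V W); split=> //; first by move=> Q [/VU].
  exists (r * f' - r' * f), (f * f') => Q [/sE[Qf Es] /tE[Qf' Et]].
  exists (prime_complM Qf Qf'); rewrite -[LHS]/(s Q - t Q) Es Et.
  rewrite /frac_prime fracN fracD; apply: eq_frac1 => /=.
  by rewrite mulNr.
- apply/asboolP => P; have [V [VP VU [r [f sE]]]] := sf P.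
  have [W [WP WU [r' [f' tE]]]] := tf P.
  exists (opens_setI V W); split=> //; first by move=> Q [/VU].
  exists (r * r'), (f * f') => Q [/sE[Qf Es] /tE[Qf' Et]].
  exists (prime_complM Qf Qf'); rewrite -[LHS]/(s Q * t Q) Es Et.
  by rewrite /frac_prime fracM; apply: eq_frac1.
Qed.

Record spec_sect U := SpecSect {
  spec_sect_val : dprod (fun P : in_open U => loc_prime (sval P));
  spec_sectP : spec_sect_val \in @locally_fracb U }.

HB.instance Definition _ U := [isSub for @spec_sect_val U].
HB.instance Definition _ U := [Choice of spec_sect U by <:].
HB.instance Definition _ U :=
  GRing.SubChoice_isSubComPzRing.Build _ (@locally_fracb U) (spec_sect U)
    (@locally_frac_subring_closed U).

Lemma spec_sect_inj U (s t : spec_sect U) :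
  (forall P, spec_sect_val s P = spec_sect_val t P) -> s = t.
Proof. by move=> st; apply: val_inj; exact: dprodP. Qed.

Lemma spec_sect_irr U (s : spec_sect U) P (h h' : oset U P) :
  spec_sect_val s (exist _ P h) = spec_sect_val s (exist _ P h').
Proof. by rewrite (Prop_irrelevance h h'). Qed.

Section Restriction.
Variables (U V : opens (spec R)) (UV : U `<=` V).

Definition in_open_sub (P : in_open U) : in_open V :=
  exist _ (sval P) (UV (proj2_sig P)).

Lemma spec_res_subproof (s : spec_sect V) :
  (fun P => spec_sect_val s (in_open_sub P)) \in @locally_fracb U.
Proof.
apply/asboolP => P; have /asboolP := spec_sectP s.
move=> /(_ (in_open_sub P))[W [WP WV [r [f sE]]]].
exists (opens_setI W U); split; first by split=> //; exact: (svalP P).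
  by move=> Q [].
by exists r, f => Q [WQ _]; exact: (sE (in_open_sub Q) WQ).
Qed.

Definition spec_res (s : spec_sect V) : spec_sect U :=
  SpecSect (spec_res_subproof s).

Lemma spec_res_zmod_morphism : zmod_morphism spec_res.
Proof. by move=> s t; exact: spec_sect_inj. Qed.

Lemma spec_res_monoid_morphism : monoid_morphism spec_res.
Proof. by split=> [|s t]; exact: spec_sect_inj. Qed.

HB.instance Definition _ := GRing.isZmodMorphism.Build
  (spec_sect V) (spec_sect U) spec_res spec_res_zmod_morphism.
HB.instance Definition _ := GRing.isMonoidMorphism.Build
  (spec_sect V) (spec_sect U) spec_res spec_res_monoid_morphism.

End Restriction.

Lemma spec_res_id U (UU : U `<=` U) s : spec_res UU s = s.
Proof.
apply: spec_sect_inj => -[P UP] /=.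
exact: (spec_sect_irr s (UU P UP) UP).
Qed.

Lemma spec_res_comp U V W (UV : U `<=` V) (VW : V `<=` W) (UW : U `<=` W) s :
  spec_res UV (spec_res VW s) = spec_res UW s.
Proof.
apply: spec_sect_inj => -[P UP] /=.
exact: (spec_sect_irr s (VW P (UV P UP)) (UW P UP)).
Qed.

Definition structure_sheaf : presheaf (spec R) :=
  @Presheaf (spec R) (fun U => spec_sect U)
    (fun U V UV => spec_res UV) spec_res_id spec_res_comp.

Lemma structure_sheaf_is_sheaf : is_sheaf structure_sheaf.
Proof.
split=> [I V U VU cov s t E|I V U VU cov s E].
  apply: spec_sect_inj => -[P UP]; have [i _ Vi] := cov P UP.
  have := congr1 (fun u => spec_sect_val u (exist _ P Vi)) (E i).
  rewrite /= => Es; rewrite (spec_sect_irr s _ (VU i P Vi)).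
  by rewrite (spec_sect_irr t _ (VU i P Vi)); exact: Es.
have idxP (P : in_open U) : {i | oset (V i) (sval P)}.
  by apply: cid; have [i _ Vi] := cov _ (proj2_sig P); exists i.
pose t (P : in_open U) : loc_prime (sval P) :=
  spec_sect_val (s (sval (idxP P))) (exist _ (sval P) (proj2_sig (idxP P))).
have tE i P (UP : oset U P) (Vi : oset (V i) P) :
    t (exist _ P UP) = spec_sect_val (s i) (exist _ P Vi).
  rewrite /t; case: (idxP (exist _ P UP)) => j /= Vj.
  pose Q : in_open (opens_setI (V j) (V i)) := exist _ P (conj Vj Vi).
  have := congr1 (fun u => spec_sect_val u Q) (E j i).
  rewrite /= => Es; rewrite (spec_sect_irr (s j) _ (subIsetl (conj Vj Vi))).
  by rewrite (spec_sect_irr (s i) _ (subIsetr (conj Vj Vi))); exact: Es.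
have tf : t \in @locally_fracb U.
  apply/asboolP => -[P UP]; have [i _ Vi] := cov P UP.
  have /asboolP/(_ (exist _ P Vi))[W [WP WV [r [f sE]]]] := spec_sectP (s i).
  exists W; split=> //; first by move=> Q /WV; exact: VU.
  exists r, f => -[Q UQ] WQ; have [Qf Es] := sE (exist _ Q (WV _ WQ)) WQ.
  by exists Qf; exact: (etrans (tE i Q UQ (WV _ WQ)) Es).
exists (SpecSect tf) => i; apply: spec_sect_inj => -[P Vi].
exact: tE.
Qed.

(* The identification of R_a with the sections of O over X_a: x is sent to the
   family of its images in the local rings R_P, for P in X_a. *)
Section Frac.
Variable a : R.

Lemma powers_prime_compl (P : in_open (basic_open a)) :
  forall s, mset (powers a) s -> exists u, mset (prime_compl (sval P)) (u * s).
Proof.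
move=> _ [n ->]; exists 1; rewrite mul1r => /prime_idealX.
by move=> /(_ (spec_prime _)); exact: (svalP P).
Qed.

Lemma spec_frac_subproof (x : loc_at a) :
  (fun P => loc_map (@powers_prime_compl P) x) \in @locally_fracb (basic_open a).
Proof.
have [r [s ->]] := fracP x; apply/asboolP => P.
exists (basic_open a); split=> //; first exact: (svalP P).
exists r, (dval s) => Q _.
have Qs : ~ spec_ideal (sval Q) (dval s).
  have [n ->] := denP s => /prime_idealX.
  by move=> /(_ (spec_prime _)); exact: (svalP Q).
by exists Qs; rewrite (@loc_mapE _ _ _ _ _ _ 1
  (@Den R (prime_compl (sval Q)) _ Qs)) /= mul1r.
Qed.

Definition spec_frac (x : loc_at a) : structure_sheaf (basic_open a) :=
  SpecSect (spec_frac_subproof x).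

End Frac.

End StructureSheaf.

Record qprim (R : comPzRingType) := QPrimPoint {
  qprim_ideal : set R;
  qprimP : quasi_primary qprim_ideal }.

Section QPrimTopology.
Variable R : comPzRingType.
Implicit Types a b : R.

HB.instance Definition _ := gen_eqMixin (qprim R).
HB.instance Definition _ := gen_choiceMixin (qprim R).

Lemma radical_qprim (Q : qprim R) : prime_ideal (radical (qprim_ideal Q)).
Proof. by have [] := qprimP Q. Qed.

Definition qprim_closed (I : set R) : set (qprim R) :=
  [set Q | I `<=` radical (qprim_ideal Q)].

Definition qprim_open : set (set (qprim R)) :=
  [set U | exists2 I, is_ideal I & U = ~` qprim_closed I].

HB.instance Definition _ := isOpenTopological.Build (qprim R)
  (zariski_openT radical_qprim : qprim_open setT)
  (zariski_openI radical_qprim : setI_closed qprim_open)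
  (zariski_open_bigU radical_qprim).

Definition qbasic_open a : opens (qprim R) :=
  Opens (zariski_open_basic radical_qprim a
    : open (~` [set Q : qprim R | radical (qprim_ideal Q) a])).

Lemma qbasic_open_subP a b : qbasic_open a `<=` qbasic_open b <->
  exists n t, (0 < n)%N /\ a ^+ n = t * b.
Proof.
split=> [ab|[n [t [n0 E]]] Q /= Qa Qb]; last first.
  apply: Qa; apply: (prime_idealX (n := n) (radical_qprim Q)).
  by rewrite E; exact: idealMl (prime_is_ideal (radical_qprim Q)) Qb.
apply: contrapT => noE; have noX n : ~ principal_ideal b (a ^+ n).
  move=> [t E]; apply: noE; exists n.+1, (a * t); split=> //.
  by rewrite exprS E mulrA.
have [P [Pp bP Pa]] := prime_avoid (principal_is_ideal b) noX.
have := ab (QPrimPoint (prime_quasi_primary Pp)); rewrite /= radical_prime //.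
by move=> /(_ Pa); apply; apply: bP; exists 1; rewrite mul1r.
Qed.

Lemma qbasic_open_powers a b : qbasic_open a `<=` qbasic_open b ->
  forall s, mset (powers b) s -> exists u, mset (powers a) (u * s).
Proof.
move=> /qbasic_open_subP[n [t [_ E]]] _ [m ->]; exists (t ^+ m), (n * m)%N.
by rewrite exprM E exprMn.
Qed.

(* The restriction map res_{U_b, U_a}; [qres_frac] is its defining formula. *)
Definition qres a b (ab : qbasic_open a `<=` qbasic_open b) :
    {rmorphism loc_at b -> loc_at a} :=
  loc_map (qbasic_open_powers ab).

Lemma qres_frac a b (ab : qbasic_open a `<=` qbasic_open b) n t r m :
  a ^+ n = t * b -> qres ab (frac_at b r m) = frac_at a (t ^+ m * r) (n * m).
Proof.
move=> E; apply: (@loc_mapE _ _ _ (qbasic_open_powers ab) r (pow_den b m)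
  (t ^+ m) (pow_den a (n * m))).
by rewrite /= exprM E exprMn.
Qed.

Lemma qres_id a (aa : qbasic_open a `<=` qbasic_open a) x : qres aa x = x.
Proof. exact: loc_map_id. Qed.

Lemma qres_comp a b c (ab : qbasic_open a `<=` qbasic_open b)
    (bc : qbasic_open b `<=` qbasic_open c)
    (ac : qbasic_open a `<=` qbasic_open c) x :
  qres ab (qres bc x) = qres ac x.
Proof. exact: loc_map_comp. Qed.

End QPrimTopology.

Section QPrimSheaf.
Variable R : comPzRingType.
Implicit Types U V W : opens (qprim R).

(* The projective limit is indexed by the a in R with U_a contained in U:
   the ring R_a attached to U_a depends on a, and when U_a = U_b the two restriction
   maps between R_a and R_b are mutually inverse. *)
Definition basic_in U := {a : R | qbasic_open a `<=` U}.

Definition compatible U (s : dprod (fun a : basic_in U => loc_at (sval a)))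
    : Prop :=
  forall (a b : basic_in U) (ab : qbasic_open (sval a) `<=` qbasic_open (sval b)),
    qres ab (s b) = s a.

Definition compatibleb U : {pred dprod (fun a : basic_in U => loc_at (sval a))} :=
  fun s => `[< compatible s >].

Lemma compatible_subring_closed U : subring_closed (@compatibleb U).
Proof.
split=> [|s t /asboolP cs /asboolP ct|s t /asboolP cs /asboolP ct];
  apply/asboolP => a b ab.
- exact: rmorph1.
- by rewrite -[LHS]/(qres ab (s b - t b)) rmorphB cs ct.
- by rewrite -[LHS]/(qres ab (s b * t b)) rmorphM cs ct.
Qed.

Record qsect U := QSect {
  qsect_val : dprod (fun a : basic_in U => loc_at (sval a));
  qsectP : qsect_val \in @compatibleb U }.

HB.instance Definition _ U := [isSub for @qsect_val U].
HB.instance Definition _ U := [Choice of qsect U by <:].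
HB.instance Definition _ U :=
  GRing.SubChoice_isSubComPzRing.Build _ (@compatibleb U) (qsect U)
    (@compatible_subring_closed U).

Lemma qsect_inj U (s t : qsect U) :
  (forall a, qsect_val s a = qsect_val t a) -> s = t.
Proof. by move=> st; apply: val_inj; exact: dprodP. Qed.

Lemma qsect_irr U (s : qsect U) a (h h' : qbasic_open a `<=` U) :
  qsect_val s (exist _ a h) = qsect_val s (exist _ a h').
Proof. by rewrite (Prop_irrelevance h h'). Qed.

Section Restriction.
Variables (U V : opens (qprim R)) (UV : U `<=` V).

Definition basic_in_sub (a : basic_in U) : basic_in V :=
  exist _ (sval a) (subset_trans (proj2_sig a) UV).

Lemma qsect_res_subproof (s : qsect V) :
  (fun a => qsect_val s (basic_in_sub a)) \in @compatibleb U.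
Proof.
apply/asboolP => a b ab; have /asboolP := qsectP s.
by move=> /(_ (basic_in_sub a) (basic_in_sub b)); exact.
Qed.

Definition qsect_res (s : qsect V) : qsect U := QSect (qsect_res_subproof s).

Lemma qsect_res_zmod_morphism : zmod_morphism qsect_res.
Proof. by move=> s t; exact: qsect_inj. Qed.

Lemma qsect_res_monoid_morphism : monoid_morphism qsect_res.
Proof. by split=> [|s t]; exact: qsect_inj. Qed.

HB.instance Definition _ := GRing.isZmodMorphism.Build
  (qsect V) (qsect U) qsect_res qsect_res_zmod_morphism.
HB.instance Definition _ := GRing.isMonoidMorphism.Build
  (qsect V) (qsect U) qsect_res qsect_res_monoid_morphism.

End Restriction.

Lemma qsect_res_id U (UU : U `<=` U) s : qsect_res UU s = s.
Proof. by apply: qsect_inj => -[a aU]; exact: (qsect_irr s (subset_trans aU UU) aU). Qed.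

Lemma qsect_res_comp U V W (UV : U `<=` V) (VW : V `<=` W) (UW : U `<=` W) s :
  qsect_res UV (qsect_res VW s) = qsect_res UW s.
Proof.
apply: qsect_inj => -[a aU].
exact: (qsect_irr s (subset_trans (subset_trans aU UV) VW) (subset_trans aU UW)).
Qed.

Definition qprim_sheaf : presheaf (qprim R) :=
  @Presheaf (qprim R) (fun U => qsect U)
    (fun U V UV => qsect_res UV) qsect_res_id qsect_res_comp.

(* The identification of R_a with the sections of the sheaf over U_a: x is sent to the
   family of its restrictions to the U_b contained in U_a. *)
Section Frac.
Variable a : R.

Lemma qfrac_subproof (x : loc_at a) :
  (fun b : basic_in (qbasic_open a) => qres (proj2_sig b) x)
    \in @compatibleb (qbasic_open a).
Proof. by apply/asboolP => b c bc; exact: qres_comp. Qed.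

Definition qfrac (x : loc_at a) : qprim_sheaf (qbasic_open a) :=
  QSect (qfrac_subproof x).

Lemma qfrac_bij : bijective qfrac.
Proof.
exists (fun s : qsect _ => qsect_val s (exist _ a (@subset_refl _ _))) => [x|s].
  exact: qres_id.
apply: qsect_inj => b; have /asboolP sc := qsectP s.
exact: (sc b (exist _ a (@subset_refl _ _)) (proj2_sig b)).
Qed.

End Frac.

End QPrimSheaf.

Section SpecIncl.
Variable R : comPzRingType.

Definition spec_incl (P : spec R) : qprim R :=
  QPrimPoint (prime_quasi_primary (spec_prime P)).

Lemma spec_incl_continuous : continuous spec_incl.
Proof.
apply/continuousP => _ [I II ->]; exists I => //.
apply/seteqP; split=> P; rewrite /= /qprim_closed /= radical_prime //;
  exact: spec_prime.
Qed.

Lemma spec_incl_preim_basic (a : R) :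
  opens_preim spec_incl_continuous (qbasic_open a) `<=` basic_open a.
Proof. by move=> P /=; rewrite radical_prime //; exact: spec_prime. Qed.

End SpecIncl.

(* Main.v *)
Require Import Defs.
From HB Require Import structures.
From mathcomp Require Import all_boot all_algebra all_classical.
From mathcomp Require Import topology_structure.
From mathcomp Require Import ring.
(* [frac] is to denote the fractions of [loc], not those of integral domains. *)
Import Defs.

(** Let iota be the inclusion of Spec R in QPrim R.  The prime P lies in U_a
    exactly when a is not in P, so iota pulls the basic open set U_a back to the
    principal open set X_a.  Both sheaves are therefore determined by the rings
    R_a: the sections of F over U are the compatible families of elements of
    R_a, for U_a inside U, and since O(X_a) = R_a, a section of O over the
    preimage of U restricts to such a family.

    The comparison map [qsect_to_spec] is written on stalks: a family (s_a) is
    sent to the section whose value at P is the image of s_a in R_P, for any a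
    with P in U_a and U_a inside U.  Two choices a and b give the same value
    because they can both be compared with U_(ab) ([qsect_germE]).  Restricted
    to X_a, the image of (s_a) is the section defined by the element s_a
    ([qsect_to_spec_basic]), so bijectivity of the comparison map reduces to
    that of R_a -> O(X_a) ([spec_frac_inj], [spec_frac_surj]); for surjectivity,
    injectivity also gives the compatibility of the family obtained.

    The bijection R_a -> O(X_a) usually rests on the quasi-compactness of X_a
    and a partition of unity.  Here these are replaced by an ideal argument
    ([power_in_ideal]): if the elements having some local property form an ideal,
    and every prime of X_a avoids one of them, then some power of a has the
    property.  It is used for the annihilator of an element (injectivity), for
    the g such that a section t is killed on X_g by a power of h, when t vanishes
    on X_h ([vanish_basic]), and for the possible denominators g of a section s,
    those for which g s comes from R_a (surjectivity).

    Finally F is a sheaf because it is isomorphic to a direct image of the sheaf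
    O ([presheaf_iso_is_sheaf]). *)

Set Implicit Arguments.
Unset Strict Implicit.
Unset Printing Implicit Defensive.

Import GRing.Theory.
Local Open Scope classical_set_scope.
Local Open Scope ring_scope.

(** * Zariski topologies *)

(** The complements of the V(a) form a base: the closed complement of U is
    V(I), and if x is not in V(I), some a in I is not in g x. *)
Lemma zariski_open_nbhs (R : comPzRingType) (T : Type) (g : T -> set R)
    (U : set T) (x : T) : zariski_open g U -> U x ->
  exists2 a, ~ g x a & [set y | ~ g y a] `<=` U.
Proof.
move=> [I _ ->] /existsNP[a /not_implyP[Ia xa]].
by exists a => // y ya /(_ a Ia).
Qed.

(** Quasi-compactness of X_a, in the form of a principle for proving that some
    power of a has a given property. *)
Lemma power_in_ideal (R : comPzRingType) (K : set R) (a : R) : is_ideal K ->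
  (forall P : spec R, ~ spec_ideal P a -> exists2 g, K g & ~ spec_ideal P g) ->
  exists n, K (a ^+ n).
Proof.
move=> iK cov; apply: contrapT => /forallNP Ka.
have [P [Pp KP Pa]] := prime_avoid iK Ka.
have [g Kg] := cov (SpecPoint Pp) Pa.
by case; exact: KP.
Qed.

(** * The canonical map to a localization *)

Section LocOf.
Variables (R : comPzRingType) (S : mulset R).

Definition loc_of (r : R) : loc S := frac r (one_den S).

Lemma loc_of_zmod_morphism : zmod_morphism loc_of.
Proof. by move=> r s; rewrite /loc_of fracN fracD; apply: eq_frac1 => /=; ring. Qed.

Lemma loc_of_monoid_morphism : monoid_morphism loc_of.
Proof. by split=> // r s; rewrite /loc_of fracM; apply: eq_frac1 => /=; ring. Qed.

HB.instance Definition _ :=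
  GRing.isZmodMorphism.Build R (loc S) loc_of loc_of_zmod_morphism.
HB.instance Definition _ :=
  GRing.isMonoidMorphism.Build R (loc S) loc_of loc_of_monoid_morphism.

Lemma loc_of_frac r s : loc_of (dval s) * frac r s = loc_of r.
Proof. by rewrite /loc_of fracM; apply: eq_frac1 => /=; ring. Qed.

Lemma loc_of_eq0 r : loc_of r = 0 <-> exists2 u, mset S u & u * r = 0.
Proof.
by rewrite frac0 /loc_of eq_frac; split=> -[u Su E]; exists u => //;
  move: E; rewrite /= mul0r mulr1 mulr0.
Qed.

Lemma loc_of_cancel s (x : loc S) : mset S s -> loc_of s * x = 0 -> x = 0.
Proof.
move=> Ss; have [r [t ->]] := fracP x; rewrite /loc_of fracM frac0.
move=> /eq_frac[u Su E]; apply/eq_frac; exists (u * s); first exact: msetM.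
by move: E; rewrite /= !mul0r !mulr1 !mulr0 mulrA.
Qed.

End LocOf.

Lemma loc_map_of (R : comPzRingType) (S T : mulset R)
    (ST : forall s, mset S s -> exists u, mset T (u * s)) r :
  loc_map ST (loc_of S r) = loc_of T r.
Proof.
by rewrite /loc_of (@loc_mapE _ _ _ ST r _ 1 (one_den T)) ?mul1r //= mulr1.
Qed.

(** * Sections of the structure sheaf over principal open sets *)

Section PrincipalSections.
Variable R : comPzRingType.
Implicit Types (P Q : spec R) (a g h r : R).

Local Notation "[ r ]_ P" := (loc_of (prime_compl P) r)
  (at level 0, r at level 99, P at level 0, format "[ r ]_ P").

(** The annihilator of r is an ideal, and it meets the complement of every P
    where r/1 vanishes. *)
Lemma loc_prime_zero_basic a r :
  (forall P, ~ spec_ideal P a -> [r]_P = 0) -> exists n, a ^+ n * r = 0.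
Proof.
move=> r0; apply: (@power_in_ideal R [set g | g * r = 0]).
  split=> [|x y /= Ex Ey|s x /= Ex] /=; first by rewrite mul0r.
    by rewrite mulrDl Ex Ey addr0.
  by rewrite -mulrA Ex mulr0.
by move=> P /r0 /loc_of_eq0[u Su E]; exists u.
Qed.

(** Near P the section is a fraction r / f on some open V.  Shrinking V to a
    basic open set X_g inside it and passing to the fraction (g r) / (f g), the
    neighbourhood becomes the principal open set of the denominator. *)
Lemma locally_fraction (U : opens (spec R)) (s : spec_sect U) (P : in_open U) :
  exists g r, ~ spec_ideal (sval P) g /\
    forall Q : in_open U, ~ spec_ideal (sval Q) g ->
      [g]_(sval Q) * spec_sect_val s Q = [r]_(sval Q).
Proof.
have /asboolP/(_ P)[V [VP _ [r [f sE]]]] := spec_sectP s.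
have [g Pg gV] := zariski_open_nbhs (oset_open V) VP.
exists (f * g), (g * r); split.
  by apply: prime_complM => //; have [] := sE P VP.
move=> Q Qfg; have Qg : ~ spec_ideal (sval Q) g.
  by move=> Qg; apply: Qfg; exact: idealMl (prime_is_ideal (spec_prime _)) Qg.
have [Qf ->] := sE Q (gV _ Qg); rewrite [f * g]mulrC !rmorphM -mulrA.
by congr (_ * _); exact: (@loc_of_frac R (prime_compl (sval Q)) r (Den _)).
Qed.

(** The g such that h^n t = 0 on X_g for some n form an ideal, because
    X_(x + y) is covered by X_x and X_y.  Near P, where t = r / g, the hypothesis
    says that r vanishes on X_(a g h), whence (a g h)^k r = 0 for some k; as a
    and g are invertible on the part of X_g that lies in X_a, this gives
    h^k t = 0 there. *)
Lemma vanish_basic a h (t : spec_sect (basic_open a)) :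
  (forall P : in_open (basic_open a), ~ spec_ideal (sval P) h ->
     spec_sect_val t P = 0) ->
  exists n, forall P : in_open (basic_open a),
    [h ^+ n]_(sval P) * spec_sect_val t P = 0.
Proof.
move=> t0.
pose K : set R := [set g | exists n, forall P : in_open (basic_open a),
  ~ spec_ideal (sval P) g -> [h ^+ n]_(sval P) * spec_sect_val t P = 0].
have [|P Pa|n [m Km]] := @power_in_ideal R K a.
- split=> [|x y [n Kx] [m Ky]|r x [n Kx]].
  + by exists 0%N => P []; exact: ideal0 (prime_is_ideal (spec_prime _)).
  + exists (n + m)%N => P Pxy; rewrite exprD rmorphM /=.
    have [Px|Px] := pselect (spec_ideal (sval P) x); last first.
      by rewrite mulrAC Kx // mul0r.
    rewrite -mulrA Ky ?mulr0 // => Py; apply: Pxy.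
    exact: idealD (prime_is_ideal (spec_prime _)) Px Py.
  + exists n => P Prx; apply: Kx => Px; apply: Prx.
    exact: idealMl (prime_is_ideal (spec_prime _)) Px.
- have [g [r [Pg tE]]] := locally_fraction t (exist _ P Pa); exists g => //.
  have [k Ek] : exists k, (a * g * h) ^+ k * r = 0.
    apply: loc_prime_zero_basic => Q Qagh.
    have [Qa Qg Qh] : [/\ ~ spec_ideal Q a, ~ spec_ideal Q g & ~ spec_ideal Q h].
      have iQ := prime_is_ideal (spec_prime Q).
      split=> Qz; apply: Qagh; last exact: idealMl.
        by rewrite -mulrA mulrC; exact: idealMl.
      by rewrite mulrAC; exact: idealMl.
    by rewrite -(tE (exist _ Q Qa) Qg) t0 // mulr0.
  (* The factor g turns t into r, and (a g)^k completes h^k to (a g h)^k. *)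
  exists k => Q Qg; apply: (loc_of_cancel (s := (a * g) ^+ k * g)).
    have Qag : ~ spec_ideal (sval Q) (a * g).
      by apply: prime_complM => //; exact: (svalP Q).
    apply: prime_complM => //.
    by move=> /(prime_idealX (spec_prime _)).
  transitivity ([(a * g) ^+ k * h ^+ k]_(sval Q)
      * ([g]_(sval Q) * spec_sect_val t Q)).
    by rewrite !rmorphM /=; ring.
  by rewrite (tE Q Qg) -rmorphM /= -exprMn Ek rmorph0.
- exists m => P; apply: Km => /(prime_idealX (spec_prime _)).
  exact: (svalP P).
Qed.

Lemma spec_frac_inj a : injective (@spec_frac R a).
Proof.
move=> x y E; apply/eqP; rewrite -subr_eq0; apply/eqP.
have xy0 P (Pa : ~ spec_ideal P a) :
    loc_map (@powers_prime_compl R a (exist _ P Pa)) (x - y) = 0.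
  apply/eqP; rewrite rmorphB subr_eq0; apply/eqP.
  pose Q : in_open (basic_open a) := exist _ P Pa.
  exact: (congr1 (fun u => spec_sect_val u Q) E).
have [r [s rs]] := fracP (x - y); rewrite rs in xy0 *.
have [n En] : exists n, a ^+ n * r = 0.
  apply: loc_prime_zero_basic => P Pa; have := xy0 P Pa.
  move=> /(congr1 ( *%R [dval s]_P)); rewrite mulr0 => <-.
  pose f := @powers_prime_compl R a (exist _ P Pa).
  by rewrite /= -!(loc_map_of f) -rmorphM /= loc_of_frac.
rewrite frac0; apply/eq_frac; exists (a ^+ n); first by exists n.
by rewrite /= !mul0r mulr1 En mulr0.
Qed.

(** The ideal is that of the denominators of s, the g such that g s comes from
    R_a.  Near P one has g s = r on X_g only; by [vanish_basic] the equality
    g^n (g s - r) = 0 holds on all of X_a for some n, so that g^(n + 1) is a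
    denominator outside P.  Hence some a^n is a denominator, and it is
    invertible in R_a. *)
Lemma spec_frac_surj a (s : spec_sect (basic_open a)) :
  exists x : loc_at a, spec_frac x = s.
Proof.
pose J : set R := [set g | exists x : loc_at a, forall P : in_open (basic_open a),
  [g]_(sval P) * spec_sect_val s P = spec_sect_val (spec_frac x) P].
have [|P Pa|n [x Ex]] := @power_in_ideal R J a.
- split=> [|g g' [x Ex] [x' Ex']|r g [x Ex]].
  + by exists 0 => P; rewrite /= !rmorph0 mul0r.
  + by exists (x + x') => P; rewrite /= !rmorphD mulrDl Ex Ex'.
  + exists (loc_of (powers a) r * x) => P.
    by rewrite /= !rmorphM -mulrA Ex /= loc_map_of.
- have [g [r [Pg sE]]] := locally_fraction s (exist _ P Pa).
  pose c y : spec_sect (basic_open a) := spec_frac (loc_of (powers a) y).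
  have cE y (Q : in_open (basic_open a)) : spec_sect_val (c y) Q = [y]_(sval Q).
    exact: loc_map_of.
  have [|n tE] := @vanish_basic a g (c g * s - c r).
    move=> Q Qg; rewrite -[LHS]/(spec_sect_val (c g) Q * spec_sect_val s Q
      - spec_sect_val (c r) Q).
    by rewrite !cE sE // subrr.
  exists (g ^+ n.+1); last by move=> /(prime_idealX (spec_prime _)).
  exists (loc_of (powers a) (g ^+ n * r)) => Q.
  rewrite /= loc_map_of; apply/eqP; rewrite -subr_eq0 -[X in _ == X](tE Q).
  rewrite -[spec_sect_val (_ - _) Q]/(spec_sect_val (c g) Q * spec_sect_val s Q
      - spec_sect_val (c r) Q) !cE exprS !rmorphM /=; apply/eqP; ring.
- exists (frac_at a 1 n * x); apply: spec_sect_inj => P.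
  have Pan : ~ spec_ideal (sval P) (a ^+ n).
    by move=> /(prime_idealX (spec_prime _)); exact: (svalP P).
  apply/eqP; rewrite -subr_eq0; apply/eqP.
  apply: (loc_of_cancel (s := a ^+ n)) => //.
  rewrite mulrBr Ex /= -(loc_map_of (powers_prime_compl P)) -rmorphM /= mulrA.
  by rewrite (loc_of_frac 1 (pow_den a n)) rmorph1 mul1r subrr.
Qed.

End PrincipalSections.

(** * The comparison map *)

Section Germ.
Variable R : comPzRingType.

Definition germ (a : R) (P : spec R) (Pa : ~ spec_ideal P a) :
    {rmorphism loc_at a -> loc_prime P} :=
  loc_map (@powers_prime_compl R a (exist _ P Pa)).

Lemma germ_qres (a b : R) (ab : qbasic_open a `<=` qbasic_open b) P
    (Pa : ~ spec_ideal P a) (Pb : ~ spec_ideal P b) x :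
  germ Pa (qres ab x) = germ Pb x.
Proof. exact: loc_map_comp. Qed.

Lemma spec_incl_qbasic (a : R) (P : spec R) :
  oset (qbasic_open a) (spec_incl P) <-> ~ spec_ideal P a.
Proof. by rewrite /= radical_prime //; exact: spec_prime. Qed.

Lemma qbasic_in (U : opens (qprim R)) (P : spec R) : oset U (spec_incl P) ->
  {a : R | qbasic_open a `<=` U /\ ~ spec_ideal P a}.
Proof.
move=> UP; apply: cid; have [a Pa aU] := zariski_open_nbhs (oset_open U) UP.
by exists a; split=> //; exact/spec_incl_qbasic.
Qed.

End Germ.

Section Comparison.
Variable R : comPzRingType.

Local Notation preim := (opens_preim (@spec_incl_continuous R)).

Section Map.
Variable U : opens (qprim R).

Definition qsect_germ (s : qsect U) (P : in_open (preim U)) : loc_prime (sval P) :=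
  let: exist a (conj aU Pa) := qbasic_in (svalP P) in
  germ Pa (qsect_val s (exist _ a aU)).

(** The choice of a made by [qbasic_in] is immaterial: any two values are the
    image of the component of s at a b. *)
Lemma qsect_germE (s : qsect U) (P : in_open (preim U)) (a : R)
    (aU : qbasic_open a `<=` U) (Pa : ~ spec_ideal (sval P) a) :
  qsect_germ s P = germ Pa (qsect_val s (exist _ a aU)).
Proof.
rewrite /qsect_germ; case: qbasic_in => b [bU Pb].
have /asboolP sc := qsectP s.
have sub (c d : R) : qbasic_open (c * d) `<=` qbasic_open c.
  by apply/qbasic_open_subP; exists 1%N, d; rewrite expr1 mulrC.
have abb : qbasic_open (a * b) `<=` qbasic_open b by rewrite mulrC; exact: sub.
have aba : qbasic_open (a * b) `<=` qbasic_open a by exact: sub.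
have abU := subset_trans aba aU.
have Pab := prime_complM Pa Pb.
pose idx c (cU : qbasic_open c `<=` U) : basic_in U := exist _ c cU.
have Ea := sc (idx _ abU) (idx _ aU) aba.
have Eb := sc (idx _ abU) (idx _ bU) abb.
by rewrite -(germ_qres aba Pab Pa) -(germ_qres abb Pab Pb) Ea Eb.
Qed.

Lemma qsect_germ_locally_frac (s : qsect U) :
  qsect_germ s \in @locally_fracb R (preim U).
Proof.
apply/asboolP => P; have [a [aU Pa]] := qbasic_in (svalP P).
have [r [d dE]] := fracP (qsect_val s (exist _ a aU)).
exists (basic_open a); split=> // [Q Qa|].
  by apply: (aU (spec_incl Q)); exact/spec_incl_qbasic.
exists r, (dval d) => Q Qa.
have Qd : ~ spec_ideal (sval Q) (dval d).
  by have [n ->] := denP d => /(prime_idealX (spec_prime _)).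
exists Qd; rewrite (qsect_germE s aU Qa) dE /germ /=.
rewrite (@loc_mapE _ _ _ _ _ _ 1 (@Den R (prime_compl (sval Q)) _ Qd)) /= mul1r //.
Qed.

Definition qsect_to_spec (s : qsect U) : spec_sect (preim U) :=
  SpecSect (qsect_germ_locally_frac s).

Lemma qsect_to_spec_zmod_morphism : zmod_morphism qsect_to_spec.
Proof.
move=> s t; apply: spec_sect_inj => P; have [a [aU Pa]] := qbasic_in (svalP P).
rewrite -[RHS]/(qsect_germ s P - qsect_germ t P) /=.
by rewrite !(qsect_germE _ aU Pa) -rmorphB.
Qed.

Lemma qsect_to_spec_monoid_morphism : monoid_morphism qsect_to_spec.
Proof.
split=> [|s t]; apply: spec_sect_inj => P;
    have [a [aU Pa]] := qbasic_in (svalP P).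
  by rewrite /= (qsect_germE _ aU Pa) -[RHS]/1; exact: rmorph1.
rewrite -[RHS]/(qsect_germ s P * qsect_germ t P) /=.
by rewrite !(qsect_germE _ aU Pa) -rmorphM.
Qed.

HB.instance Definition _ := GRing.isZmodMorphism.Build
  (qsect U) (spec_sect (preim U)) qsect_to_spec qsect_to_spec_zmod_morphism.
HB.instance Definition _ := GRing.isMonoidMorphism.Build
  (qsect U) (spec_sect (preim U)) qsect_to_spec qsect_to_spec_monoid_morphism.

Lemma basic_open_preim (a : R) : qbasic_open a `<=` U -> basic_open a `<=` preim U.
Proof. by move=> aU P Pa; apply: aU; exact/spec_incl_qbasic. Qed.

Lemma qsect_to_spec_basic (s : qsect U) (a : R) (aU : qbasic_open a `<=` U) :
  spec_res (basic_open_preim aU) (qsect_to_spec s)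
  = spec_frac (qsect_val s (exist _ a aU)).
Proof.
apply: spec_sect_inj => -[P Pa].
exact: (qsect_germE s (P := in_open_sub (basic_open_preim aU) (exist _ P Pa))).
Qed.

Lemma qsect_to_spec_inj : injective qsect_to_spec.
Proof.
move=> s t E; apply: qsect_inj => -[a aU]; apply: spec_frac_inj.
by rewrite -!qsect_to_spec_basic E.
Qed.

(** The component at a is the element of R_a that defines the restriction of u
    to X_a; its compatibility is checked in O(X_a), by injectivity. *)
Lemma qsect_to_spec_surj (u : spec_sect (preim U)) :
  exists s, qsect_to_spec s = u.
Proof.
pose ex (a : basic_in U) :=
  cid (spec_frac_surj (spec_res (basic_open_preim (proj2_sig a)) u)).
pose s a := sval (ex a).
have sE a : spec_frac (s a) = spec_res (basic_open_preim (proj2_sig a)) u.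
  exact: (svalP (ex a)).
have germ_s (a : basic_in U) P (Pa : ~ spec_ideal P (sval a))
    (UP : oset (preim U) P) : germ Pa (s a) = spec_sect_val u (exist _ P UP).
  pose Q : in_open (basic_open (sval a)) := exist _ P Pa.
  apply: etrans (congr1 (fun v => spec_sect_val v Q) (sE a)) _.
  exact: (spec_sect_irr u (P := P)).
have sc : s \in @compatibleb R U.
  apply/asboolP => a b ab; apply: spec_frac_inj; apply: spec_sect_inj.
  move=> -[P Pa].
  have Pb : ~ spec_ideal P (sval b).
    by apply/spec_incl_qbasic; apply: ab; exact/spec_incl_qbasic.
  have UP := basic_open_preim (proj2_sig a) Pa.
  apply: etrans (germ_qres ab Pa Pb (s b)) _.
  by rewrite (germ_s b P Pb UP) -(germ_s a P Pa UP).
exists (QSect sc); apply: spec_sect_inj => -[P UP].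
have [a [aU Pa]] := qbasic_in UP.
apply: etrans (qsect_germE _ (P := exist _ P UP) aU Pa) _.
exact: (germ_s (exist _ a aU) P Pa UP).
Qed.

Lemma qsect_to_spec_bij : bijective qsect_to_spec.
Proof.
exists (fun u => sval (cid (qsect_to_spec_surj u))) => [s|u]; case: cid => //= t.
exact: qsect_to_spec_inj.
Qed.

End Map.

Lemma qsect_to_spec_nat (U V : opens (qprim R)) (UV : U `<=` V) (s : qsect V) :
  qsect_to_spec (qsect_res UV s)
  = spec_res (preimage_subset UV : preim U `<=` preim V) (qsect_to_spec s).
Proof.
apply: spec_sect_inj => P; have [a [aU Pa]] := qbasic_in (svalP P).
rewrite /= (qsect_germE _ aU Pa).
exact/esym/(@qsect_germE V s (in_open_sub _ P) a (subset_trans aU UV) Pa).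
Qed.

Definition qprim_sheaf_iso :
  presheaf_iso (qprim_sheaf R)
    (direct_image (@spec_incl_continuous R) (structure_sheaf R)) :=
  @PresheafIso _ (qprim_sheaf R)
    (direct_image (@spec_incl_continuous R) (structure_sheaf R))
    (fun U => @qsect_to_spec U : {rmorphism qsect U -> spec_sect (preim U)})
    qsect_to_spec_bij qsect_to_spec_nat.

End Comparison.

(** * The isomorphism of sheaves *)

Lemma presheaf_iso_is_sheaf (T : topologicalType) (F G : presheaf T)
  (phi : presheaf_iso F G) : is_sheaf G -> is_sheaf F.
Proof.
move=> [sepG gluG]; split=> [I V U VU cov s t E|I V U VU cov s E].
  apply: (bij_inj (iso_bij phi U)); apply: (sepG I V U VU cov) => i.
  by rewrite -!iso_nat E.
have [|t tE] := gluG I V U VU cov (fun i => phi _ (s i)).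
  by move=> i j; rewrite -!iso_nat E.
have [psi _ psiK] := iso_bij phi U; exists (psi t) => i.
by apply: (bij_inj (iso_bij phi (V i))); rewrite iso_nat psiK.
Qed.

Theorem theorem3p2 (R : comPzRingType) :
  is_sheaf (qprim_sheaf R) /\
  exists phi : presheaf_iso (qprim_sheaf R)
      (direct_image (@spec_incl_continuous R) (structure_sheaf R)),
    forall (a : R) (x : loc_at a),
      phi (qbasic_open a) (qfrac x) =
      res (structure_sheaf R) (@spec_incl_preim_basic R a) (spec_frac x).
Proof.
split.
  apply: (presheaf_iso_is_sheaf (qprim_sheaf_iso R)).
  exact/direct_image_is_sheaf/structure_sheaf_is_sheaf.
exists (qprim_sheaf_iso R) => a x; apply: spec_sect_inj => P.
have Pa : ~ spec_ideal (sval P) a by exact: (spec_incl_preim_basic (svalP P)).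
rewrite /= (qsect_germE _ (@subset_refl _ _) Pa) /= qres_id.
by rewrite /germ /= (Prop_irrelevance Pa (spec_incl_preim_basic (proj2_sig P))).
Qed.
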